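(* Let $\mu$ be a probability measure on $\mathbb{R}$ satisfying the standing assumptions below and $\int_{\mathbb{R}}|x|\,d\mu<+\infty$, and let $\{y_j\}_{j\in[k]}$ (with $y_1\le\dots\le y_k$) be the support of a solution to $\min_{\lambda\in\mathcal{P}_k(\mathbb{R})}W_1(\mu,\lambda)$. Then the vector $\vec v_\mu$ defined by $(v_\mu)_j=F_\mu(y_j)$, $j\in[k]$, is an optimal percentile vector, i.e. $\lim_{n\to\infty}B^{(n)}_{ar}(\mathcal{PM}_{\vec v_\mu})=1$.
   Context: For $\vec x\in\mathbb{R}^n$, $\vec y\in\mathbb{R}^k$: $SC(\vec x,\vec y)=\frac1n\sum_i\min_j|x_i-y_j|$, $SC_{opt}(\vec x)=\min_{\vec y}SC(\vec x,\vec y)$. A percentile vector is $\vec v$ with $0\le v_1\le\dots\le v_k\le1$; $\mathcal{PM}_{\vec v}$ sorts the reports $x_{(1)}\le\dots\le x_{(n)}$ and places facility $j$ at $x_{(\lfloor(n-1)v_j\rfloor+1)}$. With $\vec X_n$ a vector of $n$ i.i.d. variables of law $\mu$, $B^{(n)}_{ar}(f)=\mathbb{E}[SC_f(\vec X_n)]/\mathbb{E}[SC_{opt}(\vec X_n)]$. A percentile vector is optimal for $\mu$ if the limit of $B^{(n)}_{ar}$ of its mechanism is $1$. $\mathcal{P}_k(\mathbb{R})$: probability measures $\sum_{j=1}^k\nu_j\delta_{x_j}$. $W_1$: 1-Wasserstein distance. $F_\mu$: c.d.f. of $\mu$. Standing assumptions on $\mu$: absolutely continuous with density $\rho_\mu$;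 support an interval on whose interior $\rho_\mu>0$; $\rho_\mu$ differentiable on the support. *)

(* Defs.v *)
From HB Require Import structures.
From mathcomp Require Import all_boot all_order all_algebra.
From mathcomp Require Import all_classical all_reals all_analysis.
Set Implicit Arguments. Unset Strict Implicit. Unset Printing Implicit Defensive.
Import Order.TTheory GRing.Theory Num.Theory.
Import numFieldNormedType.Exports.
Local Open Scope classical_set_scope.
Local Open Scope ring_scope.

Section Defs.
Variable R : realType.

Definition Fmu (mu : probability R R) (y : R) : R := fine (mu [set` `]-oo, y]]).

Definition msupport (mu : probability R R) : set R :=
  [set x | forall e : R, 0 < e -> (0%E < mu [set` `]x - e, x + e[])%O].

Definition is_density (mu : probability R R) (rho : R -> R) : Prop :=
  (forall x, 0 <= rho x) /\ measurable_fun setT rho /\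
  forall A : set R, measurable A ->
    mu A = (\int[@lebesgue_measure R]_(x in A) (rho x)%:E)%E.

Definition standing_assumptions (mu : probability R R) : Prop :=
  exists rho : R -> R,
    is_density mu rho /\
    is_interval (msupport mu) /\
    (forall x, (msupport mu)° x -> 0 < rho x) /\
    (forall x, msupport mu x ->
       cvg ((fun y => (rho y - rho x) / (y - x)) @ within (msupport mu `\ x) (nbhs x))).

Definition finite_first_moment (mu : probability R R) : Prop :=
  (\int[mu]_x (`|x|)%:E < +oo)%E.

Definition coupling (mu la : probability R R) (pi : probability (R * R)%type R) : Prop :=
  (forall A : set R, measurable A -> pi (A `*` setT) = mu A) /\
  (forall B : set R, measurable B -> pi (setT `*` B) = la B).

Definition W1 (mu la : probability R R) : \bar R :=
  ereal_inf [set (\int[pi]_p (`|p.1 - p.2|)%:E)%E | pi in coupling mu la].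

Definition discrete_repr (k : nat) (la : probability R R) (nu x : 'I_k -> R) : Prop :=
  (forall j, 0 <= nu j) /\ \sum_(j < k) nu j = 1 /\
  forall A : set R, measurable A -> la A = (\sum_(j < k) (nu j)%:E * \d_(x j) A)%E.

Definition in_Pk (k : nat) (la : probability R R) : Prop :=
  exists nu x : 'I_k -> R, discrete_repr la nu x.

Definition W1_Pk_minimizer (k : nat) (mu la : probability R R) : Prop :=
  in_Pk k la /\ forall la' : probability R R, in_Pk k la' -> (W1 mu la <= W1 mu la')%E.

Definition SC (k : nat) (xs : seq R) (ys : 'I_k -> R) : \bar R :=
  ((size xs)%:R^-1)%:E *
  (\sum_(xi <- xs) \big[Order.min/+oo%E]_(j < k) (`|xi - ys j|)%:E)%E.

Definition SCopt (k : nat) (xs : seq R) : \bar R :=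
  ereal_inf [set SC xs ys | ys in [set: 'I_k -> R]].

Definition percentile_vector (k : nat) (v : 'I_k -> R) : Prop :=
  (forall j, 0 <= v j <= 1) /\ {homo v : i j / (i <= j)%N >-> i <= j}.

(* PM_v: facility j at x_(floor((n-1) v_j) + 1) (1-indexed order statistic) *)
Definition PM (k : nat) (v : 'I_k -> R) (xs : seq R) : 'I_k -> R :=
  fun j => nth 0 (sort <=%R xs) (Num.truncn (((size xs)%:R - 1) * v j)).

(* Expectation of g(X_1, ..., X_n), X_i i.i.d. of law mu, as the iterated
   integral against mu (g nonnegative) *)
Fixpoint iid_expect (mu : probability R R) (n : nat) (g : seq R -> \bar R) : \bar R :=
  match n with
  | 0 => g [::]
  | n'.+1 => (\int[mu]_x iid_expect mu n' (fun s => g (x :: s)))%E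
  end.

Definition Bar (mu : probability R R) (k : nat) (v : 'I_k -> R) (n : nat) : R :=
  fine (iid_expect mu n (fun xs => SC xs (PM v xs))) /
  fine (iid_expect mu n (fun xs => SCopt k xs)).

Definition optimal_percentile (mu : probability R R) (k : nat) (v : 'I_k -> R) : Prop :=
  percentile_vector v /\ Bar mu v n @[n --> \oo] --> (1 : R).

End Defs.

(* Main.v *)
(** Write [phi ys] for the integral against [mu] of the distance to the nearest
    point of [ys]. The nearest-point coupling gives
    [phi y <= W1 mu la <= W1 mu la' <= phi ys], so the support [y] of a
    minimizer also minimizes [phi]. Shifting the atom [y j], which carries
    positive mass, cannot decrease the cost; hence [0 < F (y j) < 1], and since
    the support of [mu] is an interval, [F] is strictly increasing at [y j].

    Quantizing [mu] to finitely many cells and using Chebyshev-type variance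
    bounds on the cell frequencies yields a random error [G] with small
    expectation that bounds, simultaneously for all 1-Lipschitz [f], the
    difference between the empirical and the true mean of [f]. The distance to
    the nearest point of [ys] is 1-Lipschitz, so [SCopt >= phi y - G]; clamped
    linear test functions bound the distance of the order statistics used by
    [PM] to the [y j] by [e + C * G]. Thus both expected costs tend to
    [phi y > 0]. *)

Require Import Defs.
From HB Require Import structures.
From mathcomp Require Import all_boot all_order all_algebra.
From mathcomp Require Import all_classical all_reals all_analysis.
From mathcomp Require Import measurable_realfun ring lra.
Set Implicit Arguments. Unset Strict Implicit.
Import Order.TTheory GRing.Theory Num.Theory.
Import numFieldNormedType.Exports.
Local Open Scope classical_set_scope.
Local Open Scope ring_scope.

(** * Lower integrals and iterated expectations *)

Section LowerIntegral.
Context d (T : measurableType d) (R : realType).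
Variable mu : {measure set T -> \bar R}.
Local Open Scope ereal_scope.
Import HBNNSimple.

(** The integral of a nonnegative function is a supremum over the nonnegative simple functions below
    it, so monotonicity holds without measurability. This is what allows [SCopt] and iterated
    integrals to be compared directly. *)
Lemma ge0_le_integralT (f g : T -> \bar R) : (forall x, 0 <= f x) ->
  (forall x, f x <= g x) -> \int[mu]_x f x <= \int[mu]_x g x.
Proof.
move=> f0 fg; rewrite !ge0_integralTE//; last by move=> x; exact: le_trans (fg x).
by apply: ereal_sup_le => _ [h hf <-] /=; exists h => // x; exact: le_trans (fg x).
Qed.

(* The integral of a nonmeasurable nonnegative function is a lower integral,
   which is only superadditive; one measurable summand restores equality. *)
Lemma ge0_integralD_le (f : T -> \bar R) (g : T -> R) :
  (forall x, 0 <= f x) -> (forall x, (0 <= g x)%R) -> measurable_fun setT g ->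
  \int[mu]_x (f x + (g x)%:E) <= \int[mu]_x f x + \int[mu]_x (g x)%:E.
Proof.
move=> f0 g0 mg; rewrite [leLHS]ge0_integralTE; last first.
  by move=> x; rewrite adde_ge0// lee_fin.
apply: ge_ereal_sup => _ [h hfg <-]; rewrite -integralT_nnsfun.
(* The part of [h] that [g] does not cover: it is measurable, lies below [f], and [h <= k + g].
   Additivity is then applied only to the measurable pair [k], [g]. *)
pose k x := Num.max (h x - g x)%R 0%R.
have mk : measurable_fun setT k.
  by apply: measurable_maxr => //; apply: measurable_funB.
have k0 x : (0 <= k x)%R by rewrite /k le_max lexx orbT.
apply: (@le_trans _ _ (\int[mu]_x ((k x)%:E + (g x)%:E))).
  apply: ge0_le_integralT => x; first by rewrite lee_fin.
  rewrite -EFinD lee_fin -lerBlDr /k le_max lexx.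
  by [].
rewrite ge0_integralD//.
2,4: by move=> x _; rewrite lee_fin.
2,3: exact/measurable_EFinP.
apply: leeD2r; apply: ge0_le_integralT => x; first by rewrite lee_fin.
rewrite /k EFin_max ge_max f0 andbT EFinB leeBlDr//; exact: hfg.
Qed.

End LowerIntegral.

Section IidExpect.
Context {R : realType}.
Variable mu : probability R R.
Local Open Scope ereal_scope.

Lemma iid_expect_ge0 n g : (forall s, 0 <= g s) -> 0 <= iid_expect mu n g.
Proof.
elim: n g => [|n IH] g g0 //=.
by apply: integral_ge0 => x _; apply: IH => s.
Qed.

Lemma le_iid_expect n g h : (forall s, 0 <= g s) ->
  (forall s, size s = n -> g s <= h s) -> iid_expect mu n g <= iid_expect mu n h.
Proof.
elim: n g h => [|n IH] g h g0 gh /=; first exact: gh.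
apply: ge0_le_integralT => x; first exact: iid_expect_ge0.
by apply: IH => // s sn; apply: gh; rewrite /= sn.
Qed.

Lemma iid_expect0 n : iid_expect mu n (fun=> 0) = 0.
Proof. by elim: n => [|n IH] //=; under eq_integral do rewrite IH; rewrite integral0. Qed.

(* A robust form of "the expectation of [G] is at most [e]", which stays
   additive against nonmeasurable [f]. *)
Definition dominated n (G : seq R -> R) (e : R) :=
  (forall s, 0 <= G s)%R /\ forall (C : R) f,
  (0 <= C)%R -> (forall s, 0 <= f s) ->
  iid_expect mu n (fun s => f s + (C * G s)%:E) <= iid_expect mu n f + (C * e)%:E.

Lemma iid_expect_dominated n G e :
  dominated n G e -> iid_expect mu n (fun s => (G s)%:E) <= e%:E.
Proof.
move=> [G0 /(_ 1%R (fun=> 0) ler01 (fun=> lexx _))].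
rewrite iid_expect0 add0e mul1r; apply: le_trans.
apply: le_iid_expect => [s|s _]; first by rewrite lee_fin.
by rewrite add0e mul1r.
Qed.

(** The errors are removed one after the other: [f + C * G] is itself an admissible [f] for [H].
    This is why [dominated] quantifies over all nonnegative [f]. *)
Lemma dominatedD n G H e h : dominated n G e -> dominated n H h ->
  dominated n (fun s => G s + H s)%R (e + h)%R.
Proof.
move=> [G0 Ge] [H0 Hh]; split=> [s|C f C0 f0]; first exact: addr_ge0.
have fG0 s : 0 <= f s + (C * G s)%:E by rewrite adde_ge0// lee_fin mulr_ge0.
apply: (@le_trans _ _ (iid_expect mu n (fun s => f s + (C * G s)%:E + (C * H s)%:E))).
  apply: le_iid_expect => s; first by rewrite adde_ge0// lee_fin mulr_ge0// addr_ge0.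
  by move=> _; rewrite mulrDr EFinD addeA.
apply: (le_trans (Hh _ _ C0 fG0)).
by rewrite mulrDr EFinD addeA; apply: leeD2r; exact: Ge.
Qed.

Lemma dominatedZ n G e (c : R) : (0 <= c)%R -> dominated n G e ->
  dominated n (fun s => c * G s)%R (c * e)%R.
Proof.
move=> c0 [G0 Ge]; split=> [s|C f C0 f0]; first exact: mulr_ge0.
rewrite mulrA; under [X in iid_expect _ _ X]eq_fun do rewrite mulrA.
by apply: Ge => //; exact: mulr_ge0.
Qed.

Lemma le_dominated n G H e h :  (forall s, 0 <= G s)%R ->
  (forall s, size s = n -> G s <= H s)%R -> (h <= e)%R ->
  dominated n H h -> dominated n G e.
Proof.
move=> G0 GH he [H0 Hh]; split=> // C f C0 f0.
apply: (@le_trans _ _ (iid_expect mu n (fun s => f s + (C * H s)%:E))).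
  apply: le_iid_expect => [s|s sn]; first by rewrite adde_ge0// lee_fin mulr_ge0.
  by apply: leeD2l; rewrite lee_fin ler_wpM2l// GH.
by apply: (le_trans (Hh _ _ C0 f0)); apply: leeD2l; rewrite lee_fin ler_wpM2l.
Qed.

(* The hypothesis on [v] says that it is a supermartingale along the state process. *)
Lemma dominated_process (S : Type) (t : S -> R -> S) (v : nat -> S -> R) :
  (forall n a, 0 <= v n a)%R ->
  (forall n a, measurable_fun setT (fun x => v n (t a x))) ->
  (forall n a, \int[mu]_x (v n (t a x))%:E <= (v n.+1 a)%:E) ->
  forall n a, dominated n (fun s => v 0%N (foldl t a s)) (v n a).
Proof.
move=> v0 mv iv n a; split=> [s|C f C0]; first exact: v0.
elim: n a f => [|n IH] a f f0 //=.
(* The index of [v] counts the draws still to come. After the first draw [x], the inductive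
   hypothesis leaves the term [C * v n (t a x)], which is measurable in [x] and can be split off the
   lower integral. *)
apply: (@le_trans _ _ (\int[mu]_x (iid_expect mu n (fun s => f (x :: s)) +
                                    (C * v n (t a x))%:E))).
  apply: ge0_le_integralT => x; last by apply: IH => s.
  by apply: iid_expect_ge0 => s; rewrite adde_ge0// lee_fin mulr_ge0.
apply: le_trans.
  apply: ge0_integralD_le => [x|x|]; first by apply: iid_expect_ge0.
    by rewrite mulr_ge0.
  by apply: measurable_funM.
apply: leeD2l; under eq_integral do rewrite EFinM.
rewrite ge0_integralZl_EFin//.
3: exact/measurable_EFinP.
2: by move=> x _; rewrite lee_fin.
by rewrite EFinM lee_pmul// ?lee_fin// integral_ge0// => x _; rewrite lee_fin.
Qed.

Lemma integral_prob_cst (r : R) : \int[mu]_x r%:E = r%:E.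
Proof. by rewrite integral_cst//= (@probability_setT _ _ _ mu) mule1. Qed.

Lemma dominated_cst n (A : R) : (0 <= A)%R -> dominated n (fun=> A) A.
Proof.
move=> A0; have := @dominated_process unit (fun _ _ => tt) (fun _ _ => A).
move=> /(_ _ _ _ n tt); apply => // _ _.
by rewrite integral_prob_cst.
Qed.

Lemma foldl_add (w : R -> R) (a : R) s :
  foldl (fun a x => a + w x)%R a s = (a + \sum_(x <- s) w x)%R.
Proof.
elim: s a => [|x s IH] a /=; first by rewrite big_nil addr0.
by rewrite IH big_cons addrA.
Qed.

Lemma dominated_sum n (w : R -> R) (W : R) : (forall x, 0 <= w x)%R ->
  measurable_fun setT w -> \int[mu]_x (w x)%:E <= W%:E ->
  dominated n (fun s => \sum_(x <- s) w x)%R (n%:R * W)%R.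
Proof.
move=> w0 mw iw.
have W0 : (0 <= W)%R.
  by rewrite -lee_fin; apply: le_trans iw; apply: integral_ge0 => x _; rewrite lee_fin.
(* The state is the running sum. The absolute value keeps the potential nonnegative at every real
   state, including those that no sample reaches. *)
have := @dominated_process R (fun a x => a + w x)%R (fun n a => `|a| + n%:R * W)%R.
move=> /(_ _ _ _ n 0%R); rewrite normr0 add0r => H.
apply: le_dominated (H _ _ _) => //.
- by move=> s; apply: sumr_ge0.
- move=> s _; rewrite mul0r addr0 ler_normr; apply/orP; left.
  by rewrite foldl_add add0r.
- by move=> m a; rewrite addr_ge0// mulr_ge0.
- move=> m a; apply: measurable_funD => //.
  by apply: measurableT_comp => //; exact: measurable_funD.
- move=> m a.
  apply: (@le_trans _ _ (\int[mu]_x ((w x)%:E + (`|a| + m%:R * W)%:E))).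
    apply: ge0_le_integralT => x; first by rewrite lee_fin addr_ge0// mulr_ge0.
    rewrite -EFinD lee_fin addrA lerD2r addrC (le_trans (ler_normD _ _))//.
    by rewrite (ger0_norm (w0 x)).
  rewrite ge0_integralD//.
  + rewrite integral_prob_cst -natr1 mulrDl mul1r addrA [leRHS]EFinD addeC.
    exact: leeD2l.
  + by move=> x _; rewrite lee_fin.
  + exact/measurable_EFinP.
  + by move=> x _; rewrite lee_fin addr_ge0// mulr_ge0.
Qed.

(** Variance bound through the potential [a ^+ 2 + n]: a draw added to the running sum [a]
    contributes a cross term [2 * a * u x] of mean zero and a square of at most 1. *)
Lemma dominated_sqr n (u : R -> R) : measurable_fun setT u ->
  (forall x, `|u x| <= 1)%R -> \int[mu]_x (u x)%:E = 0 ->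
  dominated n (fun s => (\sum_(x <- s) u x) ^+ 2)%R n%:R.
Proof.
move=> mu_ u1 iu.
have := @dominated_process R (fun a x => a + u x)%R (fun n a => a ^+ 2 + n%:R)%R.
move=> /(_ _ _ _ n 0%R); rewrite expr0n/= add0r => H.
apply: le_dominated (H _ _ _) => //.
- by move=> s; rewrite sqr_ge0.
- by move=> s _; rewrite addr0 foldl_add add0r.
- by move=> m a; rewrite addr_ge0// sqr_ge0.
- move=> m a; apply: measurable_funD => //.
  by apply: measurable_funX; exact: measurable_funD.
- move=> m a.
  have inu : mu.-integrable setT (EFin \o u).
    apply: (@le_integrable _ _ _ mu _ _ _ (cst 1)) => //.
    + exact/measurable_EFinP.
    + by move=> x _; rewrite /= normr1 lee_fin u1.
    + exact: finite_measure_integrable_cst.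
  have icst r : mu.-integrable setT (EFin \o cst (r : R)) by exact: finite_measure_integrable_cst.
  apply: (@le_trans _ _ (\int[mu]_x (((a ^+ 2 + m.+1%:R) + (2 * a) * u x)%:E))).
    apply: ge0_le_integralT => x; first by rewrite lee_fin addr_ge0// sqr_ge0.
    rewrite lee_fin -natr1.
    have : (u x ^+ 2 <= 1)%R by rewrite -(ger0_norm (sqr_ge0 _)) normrX expr_le1.
    nra.
  under eq_integral do rewrite EFinD.
  rewrite integralD//=; first last.
  + by apply: (eq_integrable _ (fun x => (2 * a)%:E * (u x)%:E)) => //; exact: integrableZl.
  + exact: icst.
  rewrite integral_prob_cst.
  under eq_integral do rewrite EFinM.
  by rewrite integralZl// iu mule0 adde0.
Qed.

End IidExpect.

(** * A law of large numbers uniform over 1-Lipschitz functions *)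

Section LipschitzLLN.
Context {R : realType}.
Variable mu : probability R R.

Lemma dominated_bigsum n (I : Type) (r : seq I) (G : I -> seq R -> R) (e : I -> R) :
  (forall i, dominated mu n (G i) (e i)) ->
  dominated mu n (fun s => \sum_(i <- r) G i s) (\sum_(i <- r) e i).
Proof.
move=> Ge; elim: r => [|i r IH].
  rewrite big_nil; under eq_fun do rewrite big_nil.
  exact: dominated_cst.
rewrite big_cons; under eq_fun do rewrite big_cons.
exact: dominatedD.
Qed.

Definition lip1 (f : R -> R) := forall x y, `|f x - f y| <= `|x - y|.

Lemma lip1_measurable f : lip1 f -> measurable_fun setT f.
Proof.
move=> lf; apply: continuous_measurable_fun => x.
apply/cvgrPdist_lt => e e0; near=> t.
apply: le_lt_trans (lf _ _) _.
by near: t; exact: cvgr_dist_lt.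
Unshelve. all: by end_near. Qed.

Hypothesis fm : finite_first_moment mu.

Lemma lip1_integrable f : lip1 f -> mu.-integrable setT (EFin \o f).
Proof.
move=> lf; apply: (@le_integrable _ _ _ mu _ _ _ (fun x => (`|f 0|%:E + `|x|%:E)%E)) => //.
- by apply/measurable_EFinP; exact: lip1_measurable.
- move=> x _ /=; rewrite lee_fin [leRHS]ger0_norm ?addr_ge0//.
  have := lf x 0; rewrite subr0 => fx.
  by have := ler_normD (f x - f 0) (f 0); rewrite subrK; lra.
- apply: (@integrableD _ _ _ mu _ measurableT (cst `|f 0|%:E)).
    exact: finite_measure_integrable_cst.
  apply/integrableP; split; first by apply/measurable_EFinP; exact: (measurableT_comp (@normr_measurable R setT)).
  by under eq_integral do rewrite abse_EFin normr_id.
Qed.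

Lemma integrable_id : mu.-integrable setT (EFin \o (id : R -> R)).
Proof. by apply: lip1_integrable. Qed.

Lemma integrable_prob_cst (r : R) : mu.-integrable setT (EFin \o cst r).
Proof. exact: finite_measure_integrable_cst. Qed.

Lemma Rintegral_prob_cst (r : R) : \int[mu]_x r = r.
Proof. by rewrite /Rintegral integral_prob_cst. Qed.

Import HBSimple.

(** The identity is integrable, hence an L1 limit of simple functions. A close enough one serves as
    [q], and [r] lists its finite range. *)
Lemma finite_quantizer (e : R) : 0 < e -> exists (q : R -> R) (r : seq R),
  [/\ uniq r, forall x, q x \in r, measurable_fun setT q &
      (\int[mu]_x `|x - q x|%:E <= e%:E)%E].
Proof.
move=> e0.
have [g [ig _ cg]] := approximation_sfun_integrable measurableT integrable_id.
have /fine_cvgP[fn cg'] := cg.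
have lte : \forall n \near \oo, fine (\int[mu]_z `|(z%:E - (g n z)%:E)|)%E < e.
  exact: (cvgr_lt (0 : R)).
have [n [/= fin_n lt_n]] := filter_ex (filterI fn lte).
have /finite_seqP[r rE] := fimfunP (g n).
exists (g n), (undup r); split; rewrite ?undup_uniq//.
- move=> x; rewrite mem_undup; have : range (g n) (g n x) by exists x.
  by rewrite rE.
- by rewrite -[leLHS]fineK// lee_fin ltW.
Qed.

(** * Empirical frequencies of the cells of a quantizer *)

Section Cells.
Variables (q : R -> R) (r : seq R).
Hypothesis ur : uniq r.
Hypothesis qr : forall x, q x \in r.
Hypothesis mq : measurable_fun setT q.

Let p c := fine (mu (q @^-1` [set c])).
Let u c x := (q x == c)%:R - p c.

Let mcell c : measurable (q @^-1` [set c]).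
Proof. by rewrite -[X in measurable X]setTI; exact: mq. Qed.

Let cellE c x : (q x == c)%:R = \1_(q @^-1` [set c]) x :> R.
Proof.
rewrite indicE; congr (_%:R); congr nat_of_bool.
by apply/eqP/idP => [qc|/set_mem//]; exact/mem_set.
Qed.

Let mcellf c : measurable_fun setT (fun x => (q x == c)%:R : R).
Proof. by under eq_fun do rewrite cellE; exact: measurable_indic. Qed.

Let icell c : mu.-integrable setT (EFin \o (fun x => (q x == c)%:R : R)).
Proof.
apply: (@le_integrable _ _ _ mu _ _ _ (cst 1)%E) => //.
- exact/measurable_EFinP.
- by move=> x _ /=; rewrite lee_fin normr1 ger0_norm// lern1 leq_b1.
- exact: integrable_prob_cst.
Qed.

Lemma int_cell c : \int[mu]_x ((q x == c)%:R : R) = p c.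
Proof.
rewrite /Rintegral; under eq_integral do rewrite cellE.
by rewrite integral_indic// setIT.
Qed.

Lemma sum_cell (f : R -> R) x : \sum_(c <- r) f c * (q x == c)%:R = f (q x).
Proof.
rewrite (bigD1_seq (q x))//= eqxx mulr1 big1 ?addr0// => c /negbTE.
by rewrite eq_sym => ->; rewrite mulr0.
Qed.

Lemma integrable_cell_sum (f : R -> R) (s : seq R) :
  mu.-integrable setT (EFin \o (fun x => \sum_(c <- s) f c * (q x == c)%:R)).
Proof.
elim: s => [|c s IH].
  rewrite (_ : _ \o _ = EFin \o cst 0); first exact: integrable_prob_cst.
  by apply/funext => x /=; rewrite big_nil.
rewrite (_ : _ \o _ = (fun x => (f c)%:E * (EFin \o (fun x => (q x == c)%:R : R)) x)%E \+
   (EFin \o (fun x => \sum_(c <- s) f c * (q x == c)%:R))).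
  by apply: integrableD => //; exact: integrableZl.
by apply/funext => x /=; rewrite big_cons EFinD EFinM.
Qed.

Lemma Rintegral_cell_sum (f : R -> R) (s : seq R) :
  \int[mu]_x (\sum_(c <- s) f c * (q x == c)%:R) = \sum_(c <- s) f c * p c.
Proof.
elim: s => [|c s IH].
  rewrite big_nil; under eq_Rintegral do rewrite big_nil.
  by rewrite Rintegral_prob_cst.
rewrite big_cons; under eq_Rintegral do rewrite big_cons.
rewrite RintegralD//; last exact: integrable_cell_sum.
  by rewrite IH RintegralZl// int_cell.
have := integrable_cell_sum f [:: c].
by apply: eq_integrable => // x _ /=; rewrite big_seq1.
Qed.

Lemma integrable_quantized (f : R -> R) : mu.-integrable setT (EFin \o (f \o q)).
Proof.
have := integrable_cell_sum f r.
by apply: eq_integrable => // x _ /=; rewrite sum_cell.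
Qed.

Lemma Rintegral_quantized (f : R -> R) :
  \int[mu]_x f (q x) = \sum_(c <- r) f c * p c.
Proof. by rewrite -Rintegral_cell_sum; apply: eq_Rintegral => x _; rewrite sum_cell. Qed.

(* The deviations [u] sum to zero, which lets us recentre [f] at [f 0]. *)
Lemma quantized_deviation (f : R -> R) x :
  f (q x) - \int[mu]_x f (q x) = \sum_(c <- r) (f c - f 0) * u c x.
Proof.
have sumE g : g (q x) - \int[mu]_x g (q x) = \sum_(c <- r) g c * u c x.
  rewrite Rintegral_quantized -sum_cell -sumrB.
  by apply: eq_bigr => c _; rewrite mulrBr.
have := sumE (cst (f 0)); rewrite Rintegral_prob_cst subrr => /esym f0.
rewrite sumE; under [RHS]eq_bigr do rewrite mulrBl.
by rewrite sumrB [X in _ - X]f0 subr0.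
Qed.

Lemma dominated_deviation n c :
  dominated mu n (fun s => (\sum_(x <- s) u c x) ^+ 2) n%:R.
Proof.
apply: dominated_sqr.
- by apply: measurable_funB.
- have p0 : 0 <= p c by rewrite fine_ge0.
  have p1 : p c <= 1.
    by rewrite -lee_fin fineK ?fin_num_measure//; exact: probability_le1.
  by move=> x; rewrite ler_norml /u; case: (q x == c) => /=; apply/andP; split; lra.
- rewrite -[LHS]fineK; last first.
    apply: integrable_fin_num => //.
    rewrite (_ : (fun x => _) = ((EFin \o (fun x => (q x == c)%:R%R)) \- (EFin \o cst (p c)))%E).
      by apply: integrableB => //; exact: integrable_prob_cst.
    by apply/funext => x /=; rewrite EFinB.
  rewrite -/(Rintegral mu setT (u c)) RintegralB//; last exact: integrable_prob_cst.
  by rewrite int_cell Rintegral_prob_cst subrr.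
Qed.

(** The inequality [t <= d + t ^+ 2 / d] trades absolute deviations of the cell frequencies for
    squares, whose expectations are controlled. Since [f] is 1-Lipschitz, [M] bounds every
    [f c - f 0], so the right-hand side does not depend on [f]. *)
Lemma quantized_lip1_deviation (n : nat) (f : R -> R) (M d : R) s :
  (forall c, c \in r -> `|c| <= M) -> 0 < d -> (0 < n)%N -> size s = n -> lip1 f ->
  `|n%:R^-1 * \sum_(x <- s) f (q x) - \int[mu]_x f (q x)| <=
  \sum_(c <- r) (d + M ^+ 2 / d / n%:R ^+ 2 * (\sum_(x <- s) u c x) ^+ 2).
Proof.
move=> rM d0 n0 sn lf.
have n0' : 0 < n%:R :> R by rewrite ltr0n.
have -> : n%:R^-1 * \sum_(x <- s) f (q x) - \int[mu]_x f (q x) =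
    \sum_(c <- r) (f c - f 0) * (n%:R^-1 * \sum_(x <- s) u c x).
  transitivity (n%:R^-1 * \sum_(x <- s) (f (q x) - \int[mu]_x f (q x))).
    rewrite sumrB big_const_seq count_predT sn iter_addr_0 mulrBr; congr (_ - _).
    by rewrite -[X in _ * X]mulr_natl mulKf// gt_eqF.
  under eq_bigr do rewrite quantized_deviation.
  rewrite exchange_big/= mulr_sumr; apply: eq_bigr => c _.
  by rewrite mulrCA -mulr_sumr.
apply: le_trans (ler_norm_sum _ _ _) _.
rewrite big_seq [leRHS]big_seq; apply: ler_sum => c cr.
set U := \sum_(x <- s) u c x.
have M0 : 0 <= M by rewrite (le_trans _ (rM c cr)).
have fc : `|f c - f 0| <= M by apply: le_trans (rM c cr); have := lf c 0; rewrite subr0.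
rewrite normrM; apply: (@le_trans _ _ (M * `|n%:R^-1 * U|)); first by rewrite ler_wpM2r.
have -> : M ^+ 2 / d / n%:R ^+ 2 * U ^+ 2 = (M * `|n%:R^-1 * U|) ^+ 2 / d.
  rewrite exprMn real_normK ?num_real//; field; rewrite ?gt_eqF//.
set t := M * _; have t0 : 0 <= t by rewrite mulr_ge0.
rewrite -(ler_pM2r d0) mulrDl divfK ?gt_eqF//; nra.
Qed.

End Cells.

(** Three errors are added: replacing [f] by [f \o q] under [mu], replacing it on the sample, and
    the deviation of the quantized mean. Each has a bound that is the same for all 1-Lipschitz
    [f]. *)
Lemma uniform_lln (eta : R) : 0 < eta -> exists N, forall n, (N <= n)%N -> (0 < n)%N ->
  exists G, dominated mu n G eta /\ forall s f, size s = n -> lip1 f ->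
    `|n%:R^-1 * \sum_(x <- s) f x - \int[mu]_x f x| <= G s.
Proof.
(* Four terms share [eta]: one for each replacement of [f] by [f \o q], then [K * d] and the
   expected squares. *)
move=> eta0; pose e := eta / 4.
have e0 : 0 < e by rewrite divr_gt0.
have [q [r [ur qr mq iq]]] := finite_quantizer e0.
pose M := \sum_(c <- r) `|c|.
pose K : R := (size r)%:R.
pose d := e / (K + 1).
have K0 : 0 <= K by [].
have d0 : 0 < d by rewrite divr_gt0// ltr_wpDl.
(* Each squared deviation has expectation at most [n] and carries the factor [M ^+ 2 / d / n ^+ 2];
   the threshold makes the [K] of them sum to at most [e]. *)
exists (Num.truncn (K * (M ^+ 2 / d) / e)).+1 => n Nn n0.
have n0' : 0 < n%:R :> R by rewrite ltr0n.
exists (fun s => e + (n%:R^-1 * \sum_(x <- s) `|x - q x| +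
   \sum_(c <- r) (d + M ^+ 2 / d / n%:R ^+ 2 * (\sum_(x <- s) ((q x == c)%:R - fine (mu (q @^-1` [set c])))) ^+ 2))).
split.
  have c0 : 0 <= M ^+ 2 / d / n%:R ^+ 2.
    by apply: divr_ge0; [apply: divr_ge0; [exact: sqr_ge0|exact: ltW]|exact: sqr_ge0].
  have D1 := dominated_cst mu n (ltW e0).
  have D2 : dominated mu n (fun s => n%:R^-1 * \sum_(x <- s) `|x - q x|) (n%:R^-1 * (n%:R * e)).
    apply: dominatedZ; first by rewrite invr_ge0.
    apply: dominated_sum => //.
    by apply: (measurableT_comp (@normr_measurable R setT)); exact: measurable_funB.
  have D3 c := dominatedD (dominated_cst mu n (ltW d0))
    (dominatedZ c0 (dominated_deviation mq n c)).
  have D4 := dominatedD D1 (dominatedD D2 (dominated_bigsum r D3)).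
  apply: (le_dominated _ _ _ D4) => //; first by case: D4.
  rewrite mulKf ?gt_eqF// big_const_seq count_predT iter_addr_0.
  rewrite -[X in _ + (_ + X)]mulr_natl -/K mulrDr.
  have Kd : K * d <= e by rewrite /d mulrCA ler_piMr ?(ltW e0)// ler_pdivrMr; lra.
  have Kn : K * (M ^+ 2 / d / n%:R ^+ 2 * n%:R) <= e.
    have -> : K * (M ^+ 2 / d / n%:R ^+ 2 * n%:R) = K * (M ^+ 2 / d) / n%:R.
      by field; rewrite !gt_eqF.
    rewrite ler_pdivrMr// [e * _]mulrC -ler_pdivrMr//.
    apply: ltW; apply: lt_le_trans (truncnS_gt _) _.
    by rewrite ler_nat.
  by rewrite /e in Kd Kn *; lra.
move=> s f sn lf.
pose I := \int[mu]_x f (q x).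
have -> : n%:R^-1 * \sum_(x <- s) f x - \int[mu]_x f x =
   (I - \int[mu]_x f x) + (n%:R^-1 * \sum_(x <- s) (f x - f (q x)) +
     (n%:R^-1 * \sum_(x <- s) f (q x) - I)).
  rewrite sumrB; ring.
apply: le_trans (ler_normD _ _) _; apply: lerD.
  rewrite -RintegralB//; [|exact: (integrable_quantized ur qr mq f)|exact: lip1_integrable].
  have ifq : mu.-integrable setT (EFin \o (fun x => f (q x) - f x)).
    rewrite (_ : _ \o _ = ((EFin \o (f \o q)) \- (EFin \o f))%E).
      by apply: integrableB => //; [exact: (integrable_quantized ur qr mq f)|exact: lip1_integrable].
    by apply/funext => x /=; rewrite EFinB.
  rewrite -lee_fin; apply: le_trans iq.
  rewrite EFin_normr_Rintegral//; apply: le_trans (le_abse_integral _ _ _) _ => //.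
    by case/integrableP : ifq.
  apply: ge0_le_integralT => x; first exact: abse_ge0.
  by rewrite /= lee_fin distrC lf.
apply: le_trans (ler_normD _ _) _; apply: lerD.
  rewrite normrM ger0_norm ?invr_ge0// ler_wpM2l ?invr_ge0//.
  apply: le_trans (ler_norm_sum _ _ _) _; apply: ler_sum => x _; exact: lf.
apply: quantized_lip1_deviation => // c cr.
by rewrite /M (bigD1_seq c)//= lerDl sumr_ge0.
Qed.

End LipschitzLLN.

(** * Order statistics *)

Section OrderStatistics.
Context {R : realType}.

(** In the sorted list, the [size s - i] entries from position [i] on are at least the entry at [i];
    ties can only raise the count. *)
Lemma leq_count_ge_nth_sort (s : seq R) i : (i < size s)%N ->
  (size s - i <= count (>= nth 0%R (sort <=%R s) i) s)%N.
Proof.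
move=> si; set s' := sort _ s; set z := nth _ _ _.
have ss' : size s' = size s by rewrite size_sort.
rewrite -(permP (permEl (perm_sort <=%R s))) -/s' -[X in count _ X](cat_take_drop i) count_cat.
apply: leq_trans (leq_addl _ _).
suff : all (>= z) (drop i s') by rewrite all_count size_drop ss' => /eqP ->.
apply/(all_nthP 0%R) => m; rewrite size_drop ss' => mi.
rewrite nth_drop /=.
apply: (sorted_leq_nth le_trans lexx 0%R (sort_sorted le_total s)) => //.
- by rewrite inE ss'.
- by rewrite inE ss' -ltn_subRL.
- by rewrite leq_addr.
Qed.

Lemma leq_count_le_nth_sort (s : seq R) i : (i < size s)%N ->
  (i.+1 <= count (<= nth 0%R (sort <=%R s) i) s)%N.
Proof.
move=> si; set s' := sort _ s; set z := nth _ _ _.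
have ss' : size s' = size s by rewrite size_sort.
rewrite -(permP (permEl (perm_sort <=%R s))) -/s' -[X in count _ X](cat_take_drop i.+1) count_cat.
apply: leq_trans (leq_addr _ _).
have st : size (take i.+1 s') = i.+1 by rewrite size_takel// ss'.
suff : all (<= z) (take i.+1 s') by rewrite all_count st => /eqP ->.
apply/(all_nthP 0%R) => m; rewrite st => mi.
rewrite nth_take//=.
apply: (sorted_leq_nth le_trans lexx 0%R (sort_sorted le_total s)) => //.
- by rewrite inE ss' (leq_trans mi).
- by rewrite inE ss'.
Qed.

Variable mu : probability R R.
Hypothesis fm : finite_first_moment mu.

Lemma Rintegral_indic_Fmu a : \int[mu]_x (\1_([set` `]-oo, a]]) x) = Fmu mu a.
Proof. by rewrite /Rintegral integral_indic// setIT. Qed.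

Lemma integrable_indic_itv_Fmu (a : R) : mu.-integrable setT (EFin \o \1_([set` `]-oo, a]])).
Proof. exact: integrable_indic. Qed.

(** Markov's inequality for the counting measure of [s]. *)
Lemma sum_ge_count (P : pred R) (f : R -> R) (h : R) s :
  (forall x, 0 <= f x) -> (forall x, P x -> h <= f x) ->
  h * (count P s)%:R <= \sum_(x <- s) f x.
Proof.
move=> f0 fh; elim: s => [|x s IH] /=; first by rewrite big_nil mulr0.
rewrite big_cons natrD mulrDr lerD//.
by case: (boolP (P x)) => Px; rewrite ?mulr1 ?mulr0//; exact: fh.
Qed.

(** For [0 <= h] this clamps [x] to the interval from 0 to [h]: a 1-Lipschitz stand-in for [h] times
    the indicator of a half-line. *)
Let tent (h x : R) := Num.max 0 (Num.min x h).

Let tent_lip (h x y : R) : `|tent h x - tent h y| <= `|x - y|.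
Proof.
have lmax (u v : R) : `|Num.max 0 u - Num.max 0 v| <= `|u - v|.
  by case: (leP 0 u) => u0; case: (leP 0 v) => v0; rewrite ler_norml;
    apply/andP; split; (case: (ger0P (u - v)) => ?); lra.
have lmin (u v : R) : `|Num.min u h - Num.min v h| <= `|u - v|.
  by case: (leP u h) => u0; case: (leP v h) => v0; rewrite ler_norml;
    apply/andP; split; (case: (ger0P (u - v)) => ?); lra.
exact: le_trans (lmax _ _) (lmin _ _).
Qed.

Section Deviation.
Variables (s : seq R) (g : R).
Hypothesis s0 : (0 < size s)%N.
Hypothesis dev : forall f, lip1 f ->
  `|(size s)%:R^-1 * \sum_(x <- s) f x - \int[mu]_x f x| <= g.

Let n : R := (size s)%:R.
Let n0 : 0 < n. Proof. by rewrite ltr0n. Qed.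

(** The test function vanishes up to [a] and equals [h = z - a] from [z] on. Its true mean is at
    most [h * (1 - Fmu mu a)], while the [n - i] sample points from [z] on push its empirical mean
    to at least [h * (n - i) / n]. *)
Lemma order_stat_above i (a : R) : (i < size s)%N ->
  let z := nth 0 (sort <=%R s) i in a < z ->
  (z - a) * ((n - i%:R) / n - 1 + Fmu mu a) <= g.
Proof.
move=> si z az; pose h := z - a; pose f x := tent h (x - a).
have h0 : 0 <= h by rewrite subr_ge0 ltW.
have lf : lip1 f.
  by move=> x y; apply: le_trans (tent_lip _ _ _) _; rewrite opprB addrA subrK.
have f0 x : 0 <= f x by rewrite /f /tent le_max lexx.
have If : \int[mu]_x f x + h * Fmu mu a <= h.
  rewrite -Rintegral_indic_Fmu -RintegralZl//; last exact: integrable_indic_itv_Fmu.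
  have ii : mu.-integrable setT (EFin \o (fun x => h * \1_([set` `]-oo, a]]) x)).
    exact: (integrableZl _ _ (integrable_indic_itv_Fmu a)).
  have iF := lip1_integrable fm lf.
  rewrite -RintegralD// -[leRHS](Rintegral_prob_cst mu); apply: le_Rintegral => //.
  - rewrite (_ : _ \o _ = ((EFin \o f) \+ (EFin \o (fun x => h * \1_([set` `]-oo, a]]) x)%R))%E)//.
    exact: integrableD.
  - exact: integrable_prob_cst.
  - move=> x _; rewrite indicE mem_setE in_itv/= /f /tent.
    case: (leP x a) => xa; rewrite ?mulr1 ?mulr0.
      rewrite (max_idPl _) ?add0r//.
      by rewrite ge_min subr_le0 xa.
    by rewrite addr0 ge_max h0 ge_min lexx orbT.
have Sf : h * (n - i%:R) <= \sum_(x <- s) f x.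
  apply: le_trans (_ : h * (count (>= z) s)%:R <= _).
    rewrite ler_wpM2l// /n -natrB ?(ltnW si)// ler_nat.
    exact: leq_count_ge_nth_sort.
  apply: sum_ge_count => // x /= zx.
  by rewrite /f /tent le_max le_min lexx andbT lerD2r zx orbT.
have := dev lf; rewrite ler_norml => /andP[_].
apply: le_trans.
have : h * (n - i%:R) / n <= n^-1 * \sum_(x <- s) f x.
  by rewrite mulrC ler_wpM2l// invr_ge0 ltW.
rewrite -/h; lra.
Qed.

(** Mirror image: the test function equals [h = a - z] up to [z] and vanishes beyond [a]. Positions
    start at 0, so [i.+1] sample points are at most [z]. *)
Lemma order_stat_below i (a : R) : (i < size s)%N ->
  let z := nth 0 (sort <=%R s) i in z < a ->
  (a - z) * (i.+1%:R / n - Fmu mu a) <= g.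
Proof.
move=> si z az; pose h := a - z; pose f x := tent h (a - x).
have h0 : 0 <= h by rewrite subr_ge0 ltW.
have lf : lip1 f.
  move=> x y; apply: le_trans (tent_lip _ _ _) _.
  by rewrite (_ : a - x - (a - y) = y - x) 1?distrC//; ring.
have f0 x : 0 <= f x by rewrite /f /tent le_max lexx.
have If : \int[mu]_x f x <= h * Fmu mu a.
  rewrite -Rintegral_indic_Fmu -RintegralZl//; last exact: integrable_indic_itv_Fmu.
  have ii : mu.-integrable setT (EFin \o (fun x => h * \1_([set` `]-oo, a]]) x)).
    exact: (integrableZl _ _ (integrable_indic_itv_Fmu a)).
  apply: le_Rintegral => //; first exact: (lip1_integrable fm lf).
  move=> x _; rewrite indicE mem_setE in_itv/= /f /tent.
  case: (leP x a) => xa; rewrite ?mulr1 ?mulr0.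
    by rewrite ge_max h0 ge_min lexx orbT.
  by rewrite (max_idPl _) ?add0r// ge_min subr_le0 (ltW xa).
have Sf : h * i.+1%:R <= \sum_(x <- s) f x.
  apply: le_trans (_ : h * (count (<= z) s)%:R <= _).
    by rewrite ler_wpM2l// ler_nat; exact: leq_count_le_nth_sort.
  apply: sum_ge_count => // x /= zx.
  by rewrite /f /tent le_max le_min lexx andbT lerD2l lerN2 zx orbT.
have := dev lf; rewrite ler_norml => /andP[_].
apply: le_trans.
have : h * i.+1%:R / n <= n^-1 * \sum_(x <- s) f x.
  by rewrite mulrC ler_wpM2l// invr_ge0 ltW.
rewrite -/h; lra.
Qed.

End Deviation.

Lemma Fmu_ge0 y : 0 <= Fmu mu y. Proof. by rewrite fine_ge0. Qed.

Lemma Fmu_le1 y : Fmu mu y <= 1.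
Proof. by rewrite -lee_fin fineK ?fin_num_measure//; exact: probability_le1. Qed.

(** Outside the window of radius [e] around [y], [Fmu mu] differs from [p] by at least a fixed gap,
    [d1] above and [d2] below. An order statistic of rank about [n * p] that leaves the window by
    some distance forces a deviation [g] proportional to that distance. *)
Lemma order_stat_dist (y e : R) : 0 < e ->
  Fmu mu (y - e) < Fmu mu y < Fmu mu (y + e) ->
  exists C N, 0 <= C /\ forall s g, (N <= size s)%N -> (0 < size s)%N -> 0 <= g ->
   (forall f, lip1 f -> `|(size s)%:R^-1 * \sum_(x <- s) f x - \int[mu]_x f x| <= g) ->
   `|nth 0 (sort <=%R s) (Num.truncn (((size s)%:R - 1) * Fmu mu y)) - y| <= e + C * g.
Proof.
move=> e0 /andP[]; rewrite -subr_gt0 -[Fmu mu y < _]subr_gt0.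
set p := Fmu mu y; set d2 := p - _; set d1 := _ - p => d20 d10.
(* One term of [C] for each side. Above, [i <= n * p] and the whole gap [d1] is available. Below,
   rounding gives only [i.+1 > n * p - 1]; once [n > 2 / d2] this costs less than half of [d2],
   whence the factor 2. *)
exists (d1^-1 + 2 / d2), (Num.truncn (2 / d2)).+1.
split; first by rewrite addr_ge0// ?divr_ge0// ?invr_ge0// ltW.
move=> s g Ns s0 g0 dev; set i := Num.truncn _; set n : R := (size s)%:R.
have n1 : 1 <= n by rewrite ler1n.
have p0 : 0 <= p by exact: Fmu_ge0.
have p1 : p <= 1 by exact: Fmu_le1.
have x0 : 0 <= (n - 1) * p by rewrite mulr_ge0// subr_ge0.
have i1 : i%:R <= (n - 1) * p by rewrite truncn_le.
have i2 : (n - 1) * p < i.+1%:R by exact: truncnS_gt.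
(* Hence the default 0 of [nth] is never returned. *)
have isz : (i < size s)%N by rewrite -(ltr_nat R) -/n; nra.
have nd : 2 / d2 < n.
  by apply: lt_le_trans (truncnS_gt _) _; rewrite ler_nat.
have nd' : 2 < d2 * n by rewrite mulrC -ltr_pdivrMr.
set z := nth _ _ _.
have gd1 : 0 <= g / d1 by rewrite divr_ge0// ltW.
have gd2 : 0 <= g / d2 by rewrite divr_ge0// ltW.
rewrite mulrDl (mulrC d1^-1) mulrAC.
have zu : z - y <= e + g / d1.
  case: (leP z (y + e)) => ze; first by lra.
  have := order_stat_above s0 dev isz ze; rewrite -/z -/n => H.
  suff : z - (y + e) <= g / d1 by lra.
  rewrite ler_pdivlMr//; apply: le_trans H.
  rewrite ler_wpM2l ?subr_ge0 ?(ltW ze)// /d1.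
  suff : 1 - p <= (n - i%:R) / n by lra.
  by rewrite ler_pdivlMr; nra.
have zl : y - z <= e + 2 * g / d2.
  case: (leP (y - e) z) => ze; first by lra.
  have := order_stat_below s0 dev isz ze; rewrite -/z -/n => H.
  suff : y - e - z <= 2 * g / d2 by lra.
  rewrite ler_pdivlMr//.
  suff : (y - e - z) * (d2 / 2) <= g by lra.
  apply: le_trans H; rewrite ler_wpM2l ?subr_ge0 ?(ltW ze)//.
  suff : p - d2 / 2 <= i.+1%:R / n by rewrite /d2; lra.
  by rewrite ler_pdivlMr; nra.
by rewrite ler_norml; apply/andP; split; lra.
Qed.

End OrderStatistics.

(** * Quantization and the Wasserstein distance *)

Section NearestDistance.
Context {R : realType}.

(** For [k = 0] the minimum is [+oo] and [fine] sends it to 0; the lemmas that recover the minimum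
    therefore assume [0 < k]. *)
Definition near_dist k (ys : 'I_k -> R) (x : R) : R :=
  fine (\big[Order.min/+oo%E]_(j < k) (`|x - ys j|)%:E).

Section NonemptyFacilities.
Variables (k : nat) (ys : 'I_k -> R).
Hypothesis k0 : (0 < k)%N.

Lemma near_dist_attained x : exists j,
  \big[Order.min/+oo%E]_(j < k) (`|x - ys j|)%:E = `|x - ys j|%:E.
Proof.
have [j _ jE] := @eq_bigmin _ _ _ +oo%E (Ordinal k0) xpredT
  (fun j => `|x - ys j|%:E) isT (fun _ _ => leey _).
by exists j.
Qed.

Lemma near_distE x :
  \big[Order.min/+oo%E]_(j < k) (`|x - ys j|)%:E = (near_dist ys x)%:E.
Proof. by rewrite /near_dist; have [j ->] := near_dist_attained x. Qed.

Lemma near_dist_ex x : exists j, near_dist ys x = `|x - ys j|.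
Proof. by rewrite /near_dist; have [j ->] := near_dist_attained x; exists j. Qed.

Lemma near_dist_le x j : near_dist ys x <= `|x - ys j|.
Proof. by rewrite -lee_fin -near_distE; exact: bigmin_le. Qed.

Lemma near_dist_ge0 x : 0 <= near_dist ys x.
Proof. by have [j ->] := near_dist_ex x. Qed.

Lemma near_dist_lip1 : lip1 (near_dist ys).
Proof.
suff H x x' : near_dist ys x - near_dist ys x' <= `|x - x'|.
  by move=> x x'; rewrite ler_norml H andbT lerNl opprB distrC H.
have [j jE] := near_dist_ex x'.
have := near_dist_le x j.
have := ler_normD (x - x') (x' - ys j); rewrite jE addrA subrK; lra.
Qed.

End NonemptyFacilities.

Lemma near_dist_perturb k (ys zs : 'I_k -> R) (e : R) x : (0 < k)%N ->
  (forall j, `|zs j - ys j| <= e) -> near_dist zs x <= near_dist ys x + e.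
Proof.
move=> k0 ze; have [j jE] := near_dist_ex ys k0 x; rewrite jE.
have := ler_normD (x - ys j) (ys j - zs j); rewrite addrA subrK [`|ys j - _|]distrC.
by have := ze j; have := near_dist_le zs k0 x j; lra.
Qed.

End NearestDistance.

Section Pushforward.
Context d d' (T : measurableType d) (T' : measurableType d') (R : realType).

(** Packages the law of [f] together with its change of variables, so that measures and couplings
    can be transported along plain measurable functions. *)
Lemma pushforward_probability (P : probability T R) (f : T -> T') :
  measurable_fun setT f -> exists Q : probability T' R,
  (forall A, Q A = P (f @^-1` A)) /\
  (forall g : T' -> \bar R, measurable_fun setT g -> (forall y, 0 <= g y)%E ->
    \int[Q]_y g y = \int[P]_x g (f x))%E.
Proof.
move=> mf.
pose F : {mfun T >-> T'} := HB.pack f (isMeasurableFun.Build _ _ _ _ _ mf).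
exists (distribution P F); split => // g mg g0.
exact: (ge0_integral_distribution (F : {RV P >-> T'})).
Qed.

End Pushforward.

Section Quantization.
Context {R : realType}.
Variables (mu : probability R R) (k : nat).
Hypothesis fm : finite_first_moment mu.
Hypothesis k0 : (0 < k)%N.

Lemma integral_near_dist (ys : 'I_k -> R) :
  (\int[mu]_x (near_dist ys x)%:E = (\int[mu]_x near_dist ys x)%:E)%E.
Proof.
rewrite /Rintegral fineK//; apply: integrable_fin_num => //.
exact: (lip1_integrable fm (near_dist_lip1 ys k0)).
Qed.

Section NearestPoint.
Variable ys : 'I_k -> R.

(** The closed Voronoi cells of the points [ys i], which overlap at ties. The sets [A i] give each
    tie to its smallest index and thus partition the line. *)
Let B i := [set x | near_dist ys x = `|x - ys i|].
Let A i := B i `\` \bigcup_(l in [set l : 'I_k | (l < i)%N]) B l.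

Let mB i : measurable (B i).
Proof.
have mg : measurable_fun setT (fun x => near_dist ys x - `|x - ys i|).
  apply: measurable_funB; first by apply: lip1_measurable; exact: near_dist_lip1.
  by apply: (measurableT_comp (@normr_measurable R setT)); exact: measurable_funB.
have -> : B i = (fun x => near_dist ys x - `|x - ys i|) @^-1` [set 0].
  by apply/seteqP; split => x; rewrite /B /= => /eqP; rewrite ?subr_eq0;
    [rewrite -subr_eq0 => /eqP|move=> /eqP].
by rewrite -[X in measurable X]setTI; apply: mg => //; exact: measurable_set1.
Qed.

Let mA i : measurable (A i).
Proof. by apply: measurableD => //; exact: fin_bigcup_measurable. Qed.

(** The partition property in the form used later: a sum against the indicators of the cells selects
    a single coefficient, that of the first nearest point. *)
Let A_first x : exists i, near_dist ys x = `|x - ys i| /\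
  forall c : 'I_k -> R, \sum_l c l * \1_(A l) x = c i.
Proof.
have [i0 i0E] := near_dist_ex ys k0 x.
have Pi0 : `[< B i0 x >] by apply/asboolP.
case: (@arg_minnP _ i0 (fun i => `[< B i x >]) (fun i => nat_of_ord i) Pi0) => i /asboolP Bi imin.
exists i; split => // c.
rewrite (bigD1 i)//= big1.
  rewrite addr0 indicE mem_set ?mulr1//; split => // -[l /= li Bl].
  by have := imin l (asboolT Bl); rewrite leqNgt li.
move=> l li; rewrite indicE memNset ?mulr0// => -[Bl]; apply.
exists i => //=; rewrite ltn_neqAle imin ?andbT; last exact/asboolP.
by rewrite eq_sym.
Qed.

Let nu i := fine (mu (A i)).

Let integral_A (c : 'I_k -> R) : (forall i, 0 <= c i) ->
  (\int[mu]_x (\sum_i c i * \1_(A i) x)%:E = (\sum_i c i * nu i)%:E)%E.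
Proof.
move=> c0; under eq_integral do rewrite -sumEFin.
rewrite ge0_integral_sum//.
- rewrite -sumEFin; apply: eq_bigr => i _.
  under eq_integral do rewrite EFinM.
  rewrite ge0_integralZl_EFin//.
    by rewrite integral_indic// setIT EFinM fineK// fin_num_measure.
  exact/measurable_EFinP/measurable_indic.
- by move=> i; apply/measurable_EFinP; apply: measurable_funM => //; exact: measurable_indic.
- by move=> i x _; rewrite lee_fin mulr_ge0.
Qed.

(** [T] sends each point to its first nearest [ys i]. The law of [(x, T x)] couples [mu] with the
    image of [mu] under [T], and its cost is the mean distance to the nearest point. *)
Lemma W1_Pk_le_near_dist : exists la, in_Pk k la /\
  (W1 mu la <= (\int[mu]_x near_dist ys x)%:E)%E.
Proof.
pose T x := \sum_i ys i * \1_(A i) x.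
have mT : measurable_fun setT T.
  by apply: measurable_sum => i; apply: measurable_funM => //; exact: measurable_indic.
have [la [laE _]] := pushforward_probability mu mT.
exists la; split.
  exists nu, ys; split; first by move=> i; rewrite fine_ge0.
  split.
    apply: EFin_inj; have := integral_A (fun=> ler01).
    under eq_bigr do rewrite mul1r.
    move=> <-; rewrite -[RHS](integral_prob_cst mu); apply: eq_integral => x _.
    by have [i [_ ->]] := A_first x.
  move=> S mS; rewrite laE.
  have mTS : measurable (T @^-1` S) by rewrite -[X in measurable X]setTI; exact: mT.
  rewrite -[X in mu X]setIT -integral_indic//.
  under [RHS]eq_bigr do rewrite diracE muleC.
  under [RHS]eq_bigr => i _ do rewrite -[X in (X * _)%E]/(((ys i \in S)%:R : R)%:E) -EFinM.
  rewrite sumEFin -integral_A//; apply: eq_integral => x _.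
  have [i [_ iE]] := A_first x; rewrite iE indicE; congr (_%:R%:E); congr nat_of_bool.
  have Tx : T x = ys i by exact: iE.
  by apply/idP/idP => /set_mem /= H; apply/mem_set; move: H; rewrite /= Tx.
have [pi [piE piI]] := pushforward_probability mu (measurable_fun_pair (@measurable_id _ _ setT) mT).
have cpi : coupling mu la pi.
  by split => S mS; rewrite piE ?laE; congr (mu _); apply/seteqP; split => x //= [].
apply: le_trans (_ : (\int[pi]_p `|p.1 - p.2|%:E <= _)%E).
  by apply: ereal_inf_lbound; exists pi.
rewrite piI//=.
- rewrite -integral_near_dist; apply: ge0_le_integralT => x; rewrite lee_fin//.
  by have [i [-> ]] := A_first x; rewrite /T => ->.
- apply/measurable_EFinP; apply: (measurableT_comp (@normr_measurable R setT)).
  exact: measurable_funB.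
Qed.

End NearestPoint.

Lemma measurable_cost : measurable_fun setT (fun p : R * R => `|p.1 - p.2|%:E).
Proof.
apply/measurable_EFinP; apply: (measurableT_comp (@normr_measurable R setT)).
exact: measurable_funB.
Qed.

Lemma coupling_integral1 la pi (f : R -> \bar R) : coupling mu la pi ->
  measurable_fun setT f -> (forall x, 0 <= f x)%E ->
  (\int[pi]_p f p.1 = \int[mu]_x f x)%E.
Proof.
move=> [c1 _] mf f0.
have [Q [QE QI]] := pushforward_probability pi (@measurable_fst _ _ R R).
rewrite -QI//; apply: eq_measure_integral => A mA _; apply: (etrans (QE A)).
apply: (etrans _ (c1 A mA)); congr (pi _).
by apply/seteqP; split => x //= [].
Qed.

(** Under any coupling the second coordinate lies almost surely among the [ys j], so its distance to
    the first is at least the distance to the nearest of them. *)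
Lemma near_dist_le_W1 la (nu ys : 'I_k -> R) : discrete_repr la nu ys ->
  ((\int[mu]_x near_dist ys x)%:E <= W1 mu la)%E.
Proof.
move=> [_ [_ laE]]; apply: le_ereal_inf_tmp => _ [pi cpi <-].
have mnd := lip1_measurable (near_dist_lip1 ys k0).
rewrite -integral_near_dist.
rewrite -(coupling_integral1 (f := fun x => (near_dist ys x)%:E) cpi); last 2 first.
- exact/measurable_EFinP.
- by move=> x; rewrite lee_fin near_dist_ge0.
apply: ae_ge0_le_integral => //.
- by move=> p _; rewrite lee_fin near_dist_ge0.
- apply/measurable_EFinP; exact: (measurableT_comp mnd).
- exact: measurable_cost.
pose N := ~` (\bigcup_(j in [set: 'I_k]) [set ys j]).
have mN : measurable N.
  by apply: measurableC; apply: fin_bigcup_measurable => // j _; exact: measurable_set1.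
exists (setT `*` N); split.
- exact: measurableX.
- apply: (etrans (cpi.2 N mN)); rewrite laE// big1// => j _.
  by rewrite diracE memNset ?mule0// => /(_ _); apply; exists j.
- move=> p /= pN; split => // -[j _ /= pj]; apply: pN => _.
  by rewrite lee_fin pj near_dist_le.
Qed.

End Quantization.

Section ScaledIndicator.
Context d (T : measurableType d) (R : realType) (m : {measure set T -> \bar R}).

Lemma integral_scaled_indic (c : R) (S : set T) : 0 <= c -> measurable S ->
  (\int[m]_x (c * \1_S x)%:E = c%:E * m S)%E.
Proof.
move=> c0 mS; under eq_integral do rewrite EFinM.
rewrite ge0_integralZl_EFin//; first by rewrite integral_indic// setIT.
exact/measurable_EFinP/measurable_indic.
Qed.

Lemma measurable_scaled_indic (c : R) (S : set T) : measurable S ->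
  measurable_fun setT (fun x => (c * \1_S x)%:E).
Proof.
by move=> mS; apply/measurable_EFinP; apply: measurable_funM => //; exact: measurable_indic.
Qed.

End ScaledIndicator.

(** * Optimality conditions for a minimizer *)

Section Minimizer.
Context {R : realType}.
Variables (mu : probability R R) (k : nat).
Hypothesis fm : finite_first_moment mu.
Hypothesis k0 : (0 < k)%N.
Variables (la : probability R R) (nu y : 'I_k -> R).
Hypothesis minla : W1_Pk_minimizer k mu la.
Hypothesis repr : discrete_repr la nu y.

Lemma minimizer_near_dist (ys : 'I_k -> R) :
  \int[mu]_x near_dist y x <= \int[mu]_x near_dist ys x.
Proof.
rewrite -lee_fin; have [la' [inla' la'ys]] := W1_Pk_le_near_dist fm k0 ys.
apply: le_trans la'ys; apply: le_trans (minla.2 la' inla').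
exact: (near_dist_le_W1 fm k0 repr).
Qed.

Lemma W1_minimizer_fin_num : W1 mu la \is a fin_num.
Proof.
have [la' [inla' la'ys]] := W1_Pk_le_near_dist fm k0 y.
rewrite ge0_fin_numE.
  by apply: le_lt_trans (minla.2 la' inla') _; apply: le_lt_trans la'ys _; rewrite ltry.
apply: le_ereal_inf_tmp => _ [pi _ <-].
by apply: integral_ge0 => p _; rewrite lee_fin.
Qed.

(* Moving the atom [y j] by [t] gains [`|t|] on its whole mass [nu j] and
   loses at most [2 `|t|] on the points of [B]. *)
Lemma minimizer_weight_le j (t : R) (B : set R) : t != 0 -> measurable B ->
  (forall x, ~ B x -> `|x - (y j + t)| + `|t| <= `|x - y j|) ->
  nu j <= 2 * fine (mu B).
Proof.
move=> t0 mB Bt; have at0 : 0 < `|t| by rewrite normr_gt0.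
have [nu0 [nu1 laE]] := repr.
pose T u := u + t * \1_[set y j] u.
have mT : measurable_fun setT T.
  by apply: measurable_funD => //; apply: measurable_funM => //.
have [la' [la'E _]] := pushforward_probability la mT.
have inla' : in_Pk k la'.
  exists nu, (T \o y); split => //; split => // A mA; rewrite la'E laE//.
  by rewrite -[X in measurable X]setTI; exact: mT.
set w := fine (W1 mu la).
have wE : W1 mu la = w%:E by rewrite fineK// W1_minimizer_fin_num.
(* Only an inequality: other indices may carry the same location [y j]. The map [T] moves all of
   that mass. *)
have nuj : ((nu j)%:E <= la [set y j])%E.
  rewrite laE; last exact: measurable_set1.
  rewrite (bigD1 j)//= diracE mem_set// mule1 leeDl// sume_ge0// => i _.
  by rewrite mule_ge0// lee_fin.
have mB1 : measurable (B `*` [set: R]) by exact: measurableX.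
have mB2 : measurable ([set: R] `*` [set y j]).
  by apply: measurableX => //; exact: measurable_set1.
(* The infimum defining [W1] is not assumed to be attained: the bound is shown for every coupling,
   and [w] cancels afterwards. *)
suff H : ((w + `|t| * nu j - 2 * `|t| * fine (mu B))%:E <= W1 mu la)%E.
  move: H; rewrite wE lee_fin => H.
  by rewrite -(ler_pM2l at0); lra.
apply: le_ereal_inf_tmp => _ [pi [c1 c2] <-].
have mid2 : measurable_fun setT (fun p : R * R => (p.1, T p.2)).
  by apply: measurable_fun_pair => //; exact: measurableT_comp.
have [pi' [pi'E pi'I]] := pushforward_probability pi mid2.
(* Applying [T] to the second coordinate makes [pi] a coupling of [mu] with the competitor [la'], so
   minimality bounds its cost from below. *)
have wcost : (w%:E <= \int[pi]_p `|p.1 - T p.2|%:E)%E.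
  rewrite -(pi'I (fun p => `|p.1 - p.2|%:E)) => [||p]; rewrite ?lee_fin//; last exact: measurable_cost.
  rewrite -wE; apply: le_trans (minla.2 la' inla') _.
  apply: ereal_inf_lbound; exists pi' => //; split => A mA.
    by rewrite pi'E -c1//; congr (pi _); apply/seteqP; split => p //=.
  have mTA : measurable (T @^-1` A) by rewrite -[X in measurable X]setTI; exact: mT.
  by rewrite pi'E la'E -c2//; congr (pi _); apply/seteqP; split => p //=.
have mcT : measurable_fun setT (fun p : R * R => `|p.1 - T p.2|%:E).
  have := measurableT_comp measurable_cost mid2.
  exact.
(* Pointwise: nothing moves unless [u = y j]; there the hypothesis on [B] gives the gain outside
   [B], and inside [B] the triangle inequality loses at most [|t|]. *)
have : (\int[pi]_p (`|p.1 - T p.2|%:E + (`|t| * \1_([set: R] `*` [set y j]) p)%:E) <=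
        \int[pi]_p (`|p.1 - p.2|%:E + (2 * `|t| * \1_(B `*` [set: R]) p)%:E))%E.
  apply: ge0_le_integralT => [[x u]|[x u]] /=; first by rewrite -EFinD lee_fin addr_ge0// mulr_ge0.
  rewrite -!EFinD lee_fin !indicE.
  have -> : ((x, u) \in [set: R] `*` [set y j]) = (u == y j).
    by apply/idP/eqP => [/set_mem[]//|->]; exact/mem_set.
  have -> : ((x, u) \in B `*` [set: R]) = (x \in B).
    by apply/idP/idP => /set_mem => [[? _]|?]; exact/mem_set.
  have -> : T u = u + t * (u == y j)%:R.
    rewrite /T indicE; congr (_ + _ * _%:R); congr nat_of_bool.
    by apply/idP/eqP => [/set_mem//|->]; exact/mem_set.
  case: eqP => [->|_]; rewrite ?mulr1 ?mulr0 ?addr0 /=.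
    case: (boolP (x \in B)) => [xB|/negP xB]; rewrite ?mulr1 ?mulr0 ?addr0 /=.
      have := ler_normB (x - y j) t.
      by rewrite -addrA opprD; lra.
    by apply: Bt => xB'; apply: xB; exact/mem_set.
  by rewrite lerDl mulr_ge0.
rewrite ge0_integralD//; last exact: measurable_scaled_indic.
rewrite ge0_integralD//; last 2 first.
- exact: measurable_cost.
- exact: measurable_scaled_indic.
rewrite !integral_scaled_indic ?mulr_ge0//.
rewrite [X in (_ + `|t|%:E * X <= _)%E](_ : _ = la [set y j]); last first.
  by apply: c2; exact: measurable_set1.
rewrite [X in (_ <= _ + _ * X)%E](_ : _ = (fine (mu B))%:E); last first.
  by rewrite fineK ?fin_num_measure//; exact: c1.
move=> H.
have {}H : (w%:E + (`|t| * nu j)%:E <= \int[pi]_p `|p.1 - p.2|%:E + (2 * `|t| * fine (mu B))%:E)%E.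
  apply: le_trans H; apply: leeD => //.
  by rewrite EFinM lee_pmul// ?lee_fin.
rewrite EFinB leeBlDr//.
Qed.

End Minimizer.

(** * The distribution function at the atoms of a minimizer *)

Section Distribution.
Context {R : realType}.
Variable mu : probability R R.

Lemma Fmu_mono (a b : R) : a <= b -> Fmu mu a <= Fmu mu b.
Proof.
move=> ab; rewrite fine_le ?fin_num_measure// le_measure ?inE//.
exact/subset_itvl.
Qed.

Lemma measure_itv_Fmu (a b : R) : a <= b ->
  mu [set` `]a, b]] = (Fmu mu b - Fmu mu a)%:E.
Proof.
move=> ab.
suff : (mu [set` `]-oo, b]] = mu [set` `]-oo, a]] + mu [set` `]a, b]])%E.
  rewrite EFinB /Fmu !fineK ?fin_num_measure// => ->.
  by rewrite addeAC subee ?add0e// fin_num_measure.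
rewrite -measureU//.
  congr (mu _); apply/seteqP; split => x /=; rewrite !in_itv/=.
    by move=> xb; case: (leP x a) => xa; [left|right; apply/andP].
  by case=> [xa|/andP[]//]; exact: le_trans ab.
apply/seteqP; split => x //=; rewrite !in_itv/= => -[xa /andP[ax _]].
by rewrite ltNge xa in ax.
Qed.

(** The identity as a random variable: its c.d.f. is that of [mu], which gives access to the limits
    of c.d.f.s at infinity. *)
Let X : {mfun R >-> R} := HB.pack (@idfun R)
  (isMeasurableFun.Build _ _ _ _ _ (@measurable_id _ R setT)).

Lemma Fmu_lt_ex (e : R) : 0 < e -> exists t, Fmu mu t < e.
Proof.
move=> e0; have /fine_cvgP[_ H] := cvg_cdfNy0 (X : {RV mu >-> R}).
have [t tE] := filter_ex (cvgr_lt (0 : R) H _ e0).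
by exists t.
Qed.

Lemma Fmu_gt_ex (e : R) : e < 1 -> exists t, e < Fmu mu t.
Proof.
move=> e1; have /fine_cvgP[_ H] := cvg_cdfy1 (X : {RV mu >-> R}).
have [t tE] := filter_ex (cvgr_gt (1 : R) H _ e1).
by exists t.
Qed.

Lemma msupport_Fmu (s : R) :
  (forall e, 0 < e -> Fmu mu (s - e) < Fmu mu (s + e)) -> msupport mu s.
Proof.
move=> Fs e e0; have e20 : 0 < e / 2 by rewrite divr_gt0.
apply: (@lt_le_trans _ _ (mu [set` `]s - e / 2, s + e / 2]])).
  by rewrite measure_itv_Fmu; [rewrite lte_fin subr_gt0 Fs|lra].
rewrite le_measure ?inE// => x /=; rewrite !in_itv/= => /andP[? ?].
by apply/andP; split; lra.
Qed.

(** If [Fmu mu] took one value [p] at both ends, then [0 < p < 1], and the last point before [p] is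
    reached and the first after it is exceeded would be support points on either side of []a, b[].
    The midpoint would then lie in the support, although []a, b]] has no mass. *)
Lemma Fmu_no_plateau (a b : R) : is_interval (msupport mu) -> a < b ->
  0 < Fmu mu b -> Fmu mu a < 1 -> Fmu mu a < Fmu mu b.
Proof.
move=> itv ab Fa0 Fa1; rewrite lt_neqAle (Fmu_mono (ltW ab)) andbT.
apply/eqP => Fab; rewrite -Fab in Fa0; set p := Fmu mu a in Fab Fa0 Fa1.
pose S1 := [set t | Fmu mu t < p]; pose S2 := [set t | p < Fmu mu t].
have S1a : ubound S1 a.
  move=> t /= tp; rewrite leNgt; apply/negP => at_.
  by have := Fmu_mono (ltW at_); rewrite leNgt -/p tp.
have S2b : lbound S2 b.
  move=> t /= tp; rewrite leNgt; apply/negP => tb.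
  by have := Fmu_mono (ltW tb); rewrite leNgt -Fab tp.
have hS1 : has_sup S1 by split; [have [t ?] := Fmu_lt_ex Fa0; exists t|exists a].
have hS2 : has_inf S2.
  by split; [have [t ?] := Fmu_gt_ex Fa1; exists t|exists b].
have s1a : sup S1 <= a by apply: ge_sup => //; exact: hS1.1.
have s2b : b <= inf S2 by apply: lb_le_inf => //; exact: hS2.1.
have sup1 : msupport mu (sup S1).
  apply: msupport_Fmu => e e0; have [t tS1 st] := sup_adherent e0 hS1.
  apply: (le_lt_trans (Fmu_mono (ltW st))); apply: lt_le_trans tS1 _.
  rewrite leNgt; apply/negP => H.
  by have := ub_le_sup hS1.2 H; rewrite leNgt ltrDl e0.
have sup2 : msupport mu (inf S2).
  apply: msupport_Fmu => e e0; have [t tS2 st] := inf_adherent e0 hS2.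
  apply: (lt_le_trans _ (Fmu_mono (ltW st))); apply: le_lt_trans tS2.
  rewrite leNgt; apply/negP => H.
  by have := ge_inf hS2.2 H; rewrite leNgt gtrBl e0.
have mab : sup S1 <= (a + b) / 2 <= inf S2 by apply/andP; split; lra.
have h0 : 0 < (b - a) / 2 by lra.
have := itv _ _ sup1 sup2 _ mab _ h0; apply/negP; rewrite -leNgt.
apply: (@le_trans _ _ (mu [set` `]a, b]])).
  rewrite le_measure ?inE// => x /=; rewrite !in_itv/= => /andP[? ?].
  by apply/andP; split; lra.
by rewrite (measure_itv_Fmu (ltW ab)) -Fab subrr.
Qed.

Hypothesis atomless : forall x, mu [set x] = 0%E.

(** Continuity from above along closed balls shrinking to the null set [[set y]]. *)
Lemma small_ball (y e : R) : 0 < e -> exists2 t, 0 < t &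
  (mu [set` `[(y - t)%R, (y + t)%R]] < e%:E)%E.
Proof.
move=> e0; pose F n : set R := [set` `[y - n.+1%:R^-1, y + n.+1%:R^-1]].
have capF : \bigcap_n F n = [set y].
  apply/seteqP; split => x /=; last first.
    move=> -> n _; rewrite /F /= in_itv/=.
    have : 0 <= n.+1%:R^-1 :> R by rewrite invr_ge0.
    by move: (n.+1%:R^-1) => r r0; apply/andP; split; lra.
  move=> Fx; apply/eqP; rewrite -subr_eq0 -normr_eq0; apply/eqP/le_anti.
  rewrite normr_ge0 andbT leNgt; apply/negP => xy.
  have [n nE] : exists n, n.+1%:R^-1 < `|x - y|.
    exists (Num.truncn (`|x - y|^-1)).
    by rewrite invf_plt ?posrE// truncnS_gt.
  have := Fx n Logic.I; rewrite /F /= in_itv/=; move: nE; move: (n.+1%:R^-1) => r nE /andP[? ?].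
  move: nE; apply/negP; rewrite -leNgt ler_norml; apply/andP; split; lra.
have mF n : measurable (F n) by exact: measurable_itv.
have cvgF : mu \o F @ \oo --> mu (\bigcap_n F n).
  apply: nonincreasing_cvg_mu => //.
  - by rewrite -ge0_fin_numE//; exact: fin_num_measure.
  - by rewrite capF; exact: measurable_set1.
  - move=> m n mn; apply/subsetPset => x; rewrite /F /= !in_itv/=.
    have : n.+1%:R^-1 <= m.+1%:R^-1 :> R by rewrite lef_pV2 ?posrE// ler_nat.
    move: (n.+1%:R^-1) (m.+1%:R^-1) => u v uv /andP[? ?].
    by apply/andP; split; lra.
have {}cvgF : mu \o F @ \oo --> (0 : \bar R).
  by rewrite capF (atomless y) in cvgF.
have /fine_cvgP[fin_ H] := cvgF.
have [n [/= fn nE]] := filter_ex (filterI fin_ (cvgr_lt (0 : R) H _ e0)).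
exists n.+1%:R^-1; first by rewrite invr_gt0.
by rewrite -[X in (X < _)%E]fineK// lte_fin.
Qed.

(** A zero mean would put almost all mass on the finitely many [ys j], which are null. This keeps
    the limit of the denominator of [Bar] away from 0. *)
Lemma near_dist_integral_gt0 k (ys : 'I_k -> R) : (0 < k)%N ->
  finite_first_moment mu -> 0 < \int[mu]_x near_dist ys x.
Proof.
move=> k0 fm; rewrite lt_neqAle Rintegral_ge0 ?andbT; last first.
  by move=> x _; exact: near_dist_ge0.
apply/eqP => c0.
have mnd := lip1_measurable (near_dist_lip1 ys k0).
have H : (\int[mu]_x `|(near_dist ys x)%:E| = 0)%E.
  under eq_integral do rewrite gee0_abs ?lee_fin ?near_dist_ge0//.
  by rewrite integral_near_dist// -c0.
have mnde : measurable_fun setT (fun x => (near_dist ys x)%:E) by exact/measurable_EFinP.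
have /(ae_eq_integral_abs mu measurableT mnde) ae0 := H.
have aey : \forall x \ae mu, forall j, x <> ys j.
  apply: filter_forall => j; exists [set ys j].
  by split; [exact: measurable_set1|exact: atomless|move=> x /= /contrapT].
have muT : (0 < mu setT)%E by rewrite probability_setT lte_fin.
have PF := ae_properfilter_algebraOfSetsType muT.
have [x [/= x0 xy]] := filter_ex (filterI ae0 aey).
have [j jE] := near_dist_ex ys k0 x; apply: (xy j).
have := x0 Logic.I; rewrite jE => -[] /eqP; rewrite normr_eq0 subr_eq0 => /eqP.
exact.
Qed.

End Distribution.

Lemma standing_atomless (R : realType) (mu : probability R R) :
  standing_assumptions mu -> forall x, mu [set x] = 0%E.
Proof.
move=> [rho [[_ [_ rhoE]] _]] x; rewrite rhoE; last exact: measurable_set1.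
exact: integral_set1.
Qed.

(** Choose [t] so that the ball of radius [t] around [y j] has mass below [nu j / 4]. Shifting the
    atom right and left by [t] shows that the mass on either side of [y j] exceeds [nu j / 4], so
    [Fmu mu (y j)] is neither 0 nor 1 and no plateau can touch it. *)
Lemma minimizer_Fmu_strict (R : realType) (mu : probability R R) (k : nat)
    (la : probability R R) (nu y : 'I_k -> R) (j : 'I_k) (e : R) :
  standing_assumptions mu -> finite_first_moment mu ->
  W1_Pk_minimizer k mu la -> discrete_repr la nu y -> 0 < nu j -> 0 < e ->
  Fmu mu (y j - e) < Fmu mu (y j) < Fmu mu (y j + e).
Proof.
move=> sa fm minla repr nuj e0.
have k0 : (0 < k)%N by exact: leq_ltn_trans (ltn_ord j).
have nuj4 : 0 < nu j / 4 by rewrite divr_gt0.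
have [t t0 tball] := small_ball (standing_atomless sa) (y j) nuj4.
have tE : Fmu mu (y j + t) - Fmu mu (y j - t) < nu j / 4.
  rewrite -lte_fin -measure_itv_Fmu; last lra.
  apply: le_lt_trans tball.
  by rewrite le_measure ?inE//; apply: subset_itvr; rewrite bnd_simp.
(* Points beyond [y j + t] gain the full [t] from a shift to the right, so the exceptional set is
   []-oo, y j + t]]. *)
have above : nu j <= 2 * Fmu mu (y j + t).
  apply: (minimizer_weight_le fm k0 minla repr (t := t)); rewrite ?gt_eqF// => x /=.
  rewrite in_itv/= => /negP; rewrite -ltNge => xt.
  by rewrite !gtr0_norm; lra.
have below : nu j <= 2 * (1 - Fmu mu (y j - t)).
  have -> : 1 - Fmu mu (y j - t) = fine (mu [set` `]y j - t, +oo[]).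
    rewrite -setCitvl probability_setC//.
    by rewrite /Fmu fineB// fin_num_measure.
  apply: (minimizer_weight_le fm k0 minla repr (t := - t)); rewrite ?oppr_eq0 ?gt_eqF// => x /=.
  rewrite in_itv/= andbT => /negP; rewrite -leNgt => xt.
  by rewrite normrN (gtr0_norm t0) !ler0_norm; lra.
have [rho [_ [itv _]]] := sa.
have F0 : 0 < Fmu mu (y j) by have := @Fmu_mono _ mu (y j - t) (y j); lra.
have F1 : Fmu mu (y j) < 1 by have := @Fmu_mono _ mu (y j) (y j + t); lra.
apply/andP; split; apply: Fmu_no_plateau => //; rewrite ?ltrDl ?gtrBl//.
  by apply: le_lt_trans F1; apply: Fmu_mono; lra.
by apply: lt_le_trans F0 _; apply: Fmu_mono; lra.
Qed.

(** * Convergence of the expected costs *)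

Section Costs.
Context {R : realType}.
Variable mu : probability R R.

Lemma iid_expect_cst n (r : R) : iid_expect mu n (fun=> r%:E) = r%:E.
Proof.
elim: n => [|n IH] //=; under eq_integral do rewrite IH.
exact: integral_prob_cst.
Qed.

Lemma SC_near_dist k (xs : seq R) (ys : 'I_k -> R) : (0 < k)%N ->
  SC xs ys = ((size xs)%:R^-1 * \sum_(x <- xs) near_dist ys x)%:E.
Proof.
move=> k0; rewrite /SC; under eq_bigr do rewrite near_distE//.
by rewrite sumEFin EFinM.
Qed.

Lemma SC_ge0 k (xs : seq R) (ys : 'I_k -> R) : (0 < k)%N -> (0 <= SC xs ys)%E.
Proof.
move=> k0; rewrite SC_near_dist// lee_fin mulr_ge0 ?invr_ge0// sumr_ge0// => x _.
exact: near_dist_ge0.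
Qed.

Lemma SCopt_ge0 k (xs : seq R) : (0 < k)%N -> (0 <= SCopt k xs)%E.
Proof. by move=> k0; apply: le_ereal_inf_tmp => _ [ys _ <-]; exact: SC_ge0. Qed.

Hypothesis fm : finite_first_moment mu.
Variables (k : nat) (y : 'I_k -> R).
Hypothesis k0 : (0 < k)%N.
Hypothesis y_opt : forall ys : 'I_k -> R,
  \int[mu]_x near_dist y x <= \int[mu]_x near_dist ys x.
Hypothesis F_strict : forall j (e : R), 0 < e ->
  Fmu mu (y j - e) < Fmu mu (y j) < Fmu mu (y j + e).

Let c := \int[mu]_x near_dist y x.
Let v j := Fmu mu (y j).

(** Summing the constants of [order_stat_dist] over [j] makes them valid for all facilities at
    once. *)
Lemma PM_dist (e : R) : 0 < e -> exists C N, 0 <= C /\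
  forall s g, (N <= size s)%N -> (0 < size s)%N -> 0 <= g ->
   (forall f, lip1 f -> `|(size s)%:R^-1 * \sum_(x <- s) f x - \int[mu]_x f x| <= g) ->
   forall j, `|PM v s j - y j| <= e + C * g.
Proof.
move=> e0.
have /choice[CN CNE] : forall j, exists CN : R * nat, 0 <= CN.1 /\
  forall s g, (CN.2 <= size s)%N -> (0 < size s)%N -> 0 <= g ->
   (forall f, lip1 f -> `|(size s)%:R^-1 * \sum_(x <- s) f x - \int[mu]_x f x| <= g) ->
   `|PM v s j - y j| <= e + CN.1 * g.
  by move=> j; have [C [N H]] := order_stat_dist fm e0 (F_strict j e0); exists (C, N).
exists (\sum_j (CN j).1), (\sum_j (CN j).2)%N; split.
  by apply: sumr_ge0 => j _; case: (CNE j).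
move=> s g Ns s0 g0 dev j; have [_ H] := CNE j.
apply: le_trans (H s g _ s0 g0 dev) _.
  by apply: leq_trans Ns; rewrite (bigD1 j)//= leq_addr.
rewrite lerD2l ler_wpM2r// (bigD1 j)//= lerDl sumr_ge0// => i _.
by case: (CNE i).
Qed.

Lemma cost_bounds (e : R) : 0 < e -> exists N, forall n, (N <= n)%N ->
  [/\ ((c - e)%:E <= iid_expect mu n (fun xs => SCopt k xs))%E,
      (iid_expect mu n (fun xs => SCopt k xs) <=
       iid_expect mu n (fun xs => SC xs (PM v xs)))%E &
      (iid_expect mu n (fun xs => SC xs (PM v xs)) <= (c + e)%:E)%E].
Proof.
move=> e0; have e20 : 0 < e / 2 by rewrite divr_gt0.
have [C [N1 [C0 PMC]]] := PM_dist e20.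
(* With [(C + 1) * eta = e / 2], the lower bound loses [eta <= e] and the upper bound
   [e / 2 + C * eta <= e]. *)
pose eta := e / 2 / (C + 1).
have eta0 : 0 < eta by rewrite divr_gt0// ltr_wpDl.
have etae : (C + 1) * eta = e / 2 by rewrite mulrC divfK// gt_eqF// ltr_wpDl.
have [N2 lln] := uniform_lln fm eta0.
exists (N1 + N2).+1 => n Nn.
have n0 : (0 < n)%N by exact: leq_trans Nn.
have n0' : 0 < n%:R :> R by rewrite ltr0n.
have [G [Gdom Gdev]] : exists G, dominated mu n G eta /\ forall s f, size s = n -> lip1 f ->
    `|n%:R^-1 * \sum_(x <- s) f x - \int[mu]_x f x| <= G s.
  by apply: lln => //; apply: leq_trans (ltnW Nn); rewrite leq_addl.
have c0 : 0 <= c by apply: Rintegral_ge0 => x _; exact: near_dist_ge0.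
split.
(* The error is added to [SCopt] instead of being subtracted from [c]: domination of [G] then
   applies without measurability of [SCopt]. *)
- suff H : (c%:E <= iid_expect mu n (fun xs => SCopt k xs) + eta%:E)%E.
    rewrite EFinB leeBlDr//; apply: le_trans H _; apply: leeD2l; rewrite lee_fin.
    nra.
  have := Gdom.2 1 (fun xs => SCopt k xs) ler01 (fun s => SCopt_ge0 s k0).
  rewrite mul1r; apply: le_trans.
  rewrite -(iid_expect_cst n c); apply: le_iid_expect => [s|s sn]; first by rewrite lee_fin.
  rewrite mul1r -leeBlDr// -EFinB; apply: le_ereal_inf_tmp => _ [ys _ <-].
  rewrite SC_near_dist// lee_fin sn.
  have := Gdev s _ sn (near_dist_lip1 ys k0); rewrite ler_norml => /andP[+ _].
  by have := y_opt ys; rewrite -/c; lra.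
- apply: le_iid_expect => [s|s _]; first exact: SCopt_ge0.
  by apply: ereal_inf_lbound; exists (PM v s).
(* The cost of the fixed facilities [y], of mean [c], plus the displacement allowed by [PM_dist];
   only the displacement involves [G]. *)
- pose H s := n%:R^-1 * (\sum_(x <- s) near_dist y x) + (e / 2 + C * G s).
  have Hdom : dominated mu n H (c + e).
    have D1 : dominated mu n (fun s => \sum_(x <- s) near_dist y x) (n%:R * c).
      apply: dominated_sum => [x||]; first exact: near_dist_ge0.
        exact: lip1_measurable (near_dist_lip1 y k0).
      by rewrite integral_near_dist.
    have ni0 : 0 <= n%:R^-1 :> R by rewrite invr_ge0.
    have D := dominatedD (dominatedZ ni0 D1)
      (dominatedD (dominated_cst mu n (ltW e20)) (dominatedZ C0 Gdom)).
    apply: (le_dominated D.1 _ _ D) => //.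
    rewrite mulKf ?gt_eqF// lerD2l.
    nra.
  apply: le_trans (iid_expect_dominated Hdom).
  apply: le_iid_expect => [s|s sn]; first exact: SC_ge0.
  rewrite SC_near_dist// lee_fin sn /H.
  rewrite -[e / 2 + _](mulKf (_ : n%:R != 0 :> R)) ?gt_eqF// -mulrDr ler_wpM2l ?invr_ge0//.
  have -> : n%:R * (e / 2 + C * G s) = \sum_(x <- s) (e / 2 + C * G s).
    by rewrite big_const_seq count_predT sn iter_addr_0 mulr_natl.
  rewrite -big_split/=.
  apply: ler_sum => x _; apply: near_dist_perturb => // j.
  apply: PMC; rewrite ?sn//; last by move=> f lf; exact: Gdev.
    by apply: leq_trans (ltnW Nn); rewrite leq_addr.
  exact: Gdom.1.
Qed.

Lemma Bar_cvg1 : 0 < c -> Bar mu v n @[n --> \oo] --> (1 : R).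
Proof.
move=> c0.
have bnd e : 0 < e -> \forall n \near \oo,
    `|c - fine (iid_expect mu n (fun xs => SC xs (PM v xs)))| <= e /\
    `|c - fine (iid_expect mu n (fun xs => SCopt k xs))| <= e.
  move=> e0; have [N HN] := cost_bounds e0.
  exists N => // n /= /HN[].
  set A := iid_expect mu n _; set B := iid_expect mu n _ => cA AB Bc.
  have A0 : (0 <= A)%E by apply: iid_expect_ge0 => s; exact: SCopt_ge0.
  have B0 : (0 <= B)%E by exact: le_trans AB.
  (* Both expectations are finite, so [fine] in [Bar] loses nothing. *)
  have Bf : B \is a fin_num by rewrite ge0_fin_numE// (le_lt_trans Bc)// ltry.
  have Af : A \is a fin_num by rewrite ge0_fin_numE// (le_lt_trans (le_trans AB Bc))// ltry.
  move: cA AB Bc; rewrite -(fineK Af) -(fineK Bf) !lee_fin /=.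
  move: (fine A) (fine B) => a b ? ? ?.
  by split; rewrite ler_norml; apply/andP; split; lra.
have cPM : fine (iid_expect mu n (fun xs => SC xs (PM v xs))) @[n --> \oo] --> c.
  apply/cvgrPdist_le => e e0; have := bnd e e0.
  by apply: filterS => n [].
have copt : fine (iid_expect mu n (fun xs => SCopt k xs)) @[n --> \oo] --> c.
  apply/cvgrPdist_le => e e0; have := bnd e e0.
  by apply: filterS => n [].
rewrite -(divff (lt0r_neq0 c0)); apply: cvgM => //.
by apply: cvgV => //; exact: lt0r_neq0.
Qed.

End Costs.

Unset Implicit Arguments.

Theorem theorem5 (R : realType) (mu : probability R R) (k : nat)
    (la : probability R R) (nu y : 'I_k -> R) :
  standing_assumptions mu ->
  finite_first_moment mu ->
  W1_Pk_minimizer k mu la ->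
  discrete_repr la nu y -> (forall j, 0 < nu j) ->
  {homo y : i j / (i <= j)%N >-> i <= j} ->
  optimal_percentile mu (fun j => Fmu mu (y j)).
Proof.
move=> sa fm minla repr nu0 ymono.
(* With no atoms the weights would sum to 0 instead of 1. *)
have k0 : (0 < k)%N.
  case: k nu y repr {nu0 ymono minla} => // nu y [_ [+ _]].
  by rewrite big_ord0 => /eqP; rewrite eq_sym oner_eq0.
split.
  split=> [j|i j ij]; first by rewrite Fmu_ge0 Fmu_le1.
  by apply: Fmu_mono; exact: ymono.
apply: Bar_cvg1 => //.
- exact: (minimizer_near_dist fm k0 minla repr).
- by move=> j e e0; exact: (minimizer_Fmu_strict sa fm minla repr).
- by apply: near_dist_integral_gt0 => //; exact: standing_atomless.
Qed.
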